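(* Let $X=\mathbb{R}^n$ with the standard inner product and induced norm $\|\cdot\|$, and let $\mathfrak{q}=\tfrac12\|\cdot\|^2$. Let $f\colon X\to\left]-\infty,+\infty\right]$ be convex, lower semicontinuous and proper, and let $\lambda\in\left]0,1\right[$. Let $G_\lambda f=(1-\lambda^2)\,e_\lambda f+\lambda\mathfrak{q}$ be the Goebel smoothing operator applied to $f$, where $e_\lambda f$ is the Moreau envelope of $f$, and let $\operatorname{pav}$ denote the proximal average. Then the following hold. (i) $G_\lambda f=(1+\lambda)\operatorname{pav}(f,0;1-\lambda,\lambda)+\lambda\mathfrak{q}$, where $0$ denotes the zero function on $X$. (ii) $G_\lambda f=(1+\lambda)^2\operatorname{pav}\left(f,\mathfrak{q};\frac{1-\lambda}{1+\lambda},\frac{2\lambda}{1+\lambda}\right)\circ\left((1+\lambda)^{-1}\operatorname{Id}\right)$; that is, for every $x\in X$, $(G_\lambda f)(x)=(1+\lambda)^2\operatorname{pav}\left(f,\mathfrak{q};\frac{1-\lambda}{1+\lambda},\frac{2\lambda}{1+\lambda}\right)\left(\frac{x}{1+\lambda}\right)$. (iii) $(G_\lambda f)^*=G_\lambda(f^* )$.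
   Context: $X=\mathbb{R}^n$ is the standard Euclidean space with inner product $\langle\cdot,\cdot\rangle$ and induced norm $\|\cdot\|$; $\mathfrak{q}=\tfrac12\|\cdot\|^2$; $\operatorname{Id}\colon X\to X\colon x\mapsto x$ is the identity operator. Fenchel conjugate: $f^*(x^* )=\sup_{x\in X}\big(\langle x,x^*\rangle-f(x)\big)$. Infimal convolution: $(f_1\,\square\, f_2)(x)=\inf_{y\in X}\big(f_1(y)+f_2(x-y)\big)$. Moreau envelope: for $\lambda>0$, $e_\lambda f=f\,\square\,\lambda^{-1}\mathfrak{q}$, i.e. $(e_\lambda f)(x)=\inf_{y\in X}\big(f(y)+\tfrac{1}{2\lambda}\|x-y\|^2\big)$. Goebel smoothing operator: for $f\colon X\to\left]-\infty,+\infty\right]$ convex, lower semicontinuous and proper, and $\lambda\in\left]0,1\right[$, $G_\lambda f=(1-\lambda^2)\,e_\lambda f+\lambda\mathfrak{q}$. Proximal average: for convex, lower semicontinuous and proper functions $f_1,f_2\colon X\to\left]-\infty,+\infty\right]$ and $\lambda_1,\lambda_2>0$ with $\lambda_1+\lambda_2=1$, $$\operatorname{pav}(f_1,f_2;\lambda_1,\lambda_2)=\big(\lambda_1(f_1+\mathfrak{q})^*+\lambda_2(f_2+\mathfrak{q})^*\big)^*-\mathfrak{q}.$$ *)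

(* Defs.v *)
From HB Require Import structures.
From mathcomp Require Import all_boot all_order all_algebra.
From mathcomp Require Import all_classical all_reals all_analysis.
Set Implicit Arguments.
Unset Strict Implicit.
Unset Printing Implicit Defensive.
Import Order.TTheory GRing.Theory Num.Theory.
Import numFieldNormedType.Exports.
Local Open Scope classical_set_scope.
Local Open Scope ring_scope.
Local Open Scope ereal_scope.

(* The canonical norm `|x| on 'rV[R]_n is the max-norm, hence the separate
   Euclidean norm [enorm]. Both norms induce the same topology, so the library's
   [lower_semicontinuous] on 'rV[R]_n is the usual notion on R^n. *)

Section convex_analysis.
Context {R : realType} {n : nat}.
Local Notation X := 'rV[R]_n.
Implicit Types (f : X -> \bar R) (x y u : X) (l : R).

Definition dot x y : R := (\sum_(i < n) x ord0 i * y ord0 i)%R.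

Definition enorm x : R := Num.sqrt (dot x x).

Definition q x : \bar R := (2^-1 * enorm x ^+ 2)%:E.

(* The condition -oo < f x also expresses that f takes values in ]-oo, +oo]. *)
Definition proper_fun f :=
  (forall x, -oo < f x) /\ (exists x, f x < +oo).

(* Only meaningful for functions that avoid -oo, since (+oo) + (-oo) = -oo
   in \bar R. *)
Definition convex_fun f := forall x y (t : R), (0 < t < 1)%R ->
  f (t *: x + (1 - t) *: y)%R <= t%:E * f x + (1 - t)%:E * f y.

Definition conjugate f u : \bar R :=
  ereal_sup [set (dot x u)%:E - f x | x in [set: X]].

Definition inf_conv (f1 f2 : X -> \bar R) x : \bar R :=
  ereal_inf [set f1 y + f2 (x - y)%R | y in [set: X]].

Definition moreau l f : X -> \bar R := inf_conv f (fun z => (l^-1)%:E * q z).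

Definition goebel l f x : \bar R :=
  (1 - l ^+ 2)%:E * moreau l f x + l%:E * q x.

Definition pav (f1 f2 : X -> \bar R) (l1 l2 : R) x : \bar R :=
  conjugate (fun u => l1%:E * conjugate (f1 \+ q) u
                    + l2%:E * conjugate (f2 \+ q) u) x - q x.

End convex_analysis.

(* Main.v *)
(* Every x is p + l v for some subgradient v of f at p: p is the proximal point
   of f at x, which exists because f + (2l)^-1 |. - x|^2 is lower
   semicontinuous and coercive. At such a pair (p, v) each operation of the
   theorem is explicit: f^*(v) = <p, v> - f(p), e_l f (p + l v) =
   f(p) + l/2 |v|^2 with subgradient v there, and p is a subgradient of f^* at
   v, so that no biconjugation or minimax theorem is needed. Choosing in each
   part the pair adapted to the point reduces the claim to an identity between
   polynomials in f(p), <p, p>, <p, v>, <v, v>. *)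
Require Import Defs.
From HB Require Import structures.
From mathcomp Require Import all_boot all_order all_algebra.
From mathcomp Require Import all_classical all_reals all_analysis.
From mathcomp Require Import ring lra.
Set Implicit Arguments.
Unset Strict Implicit.
Unset Printing Implicit Defensive.
Import Order.TTheory GRing.Theory Num.Theory.
Import numFieldNormedType.Exports.
Local Open Scope ring_scope.
Local Open Scope ereal_scope.

(** * Euclidean inner product and its comparison with the max-norm *)

Section dot.
Context {R : realType} {n : nat}.
Implicit Types (x y z : 'rV[R]_n) (a : R).

Lemma dotC x y : dot x y = dot y x.
Proof. by apply: eq_bigr => i _; rewrite mulrC. Qed.

Lemma dotDl x y z : dot (x + y)%R z = (dot x z + dot y z)%R.
Proof. by rewrite -big_split; apply: eq_bigr => i _; rewrite mxE mulrDl. Qed.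

Lemma dotZl a x y : dot (a *: x)%R y = (a * dot x y)%R.
Proof. by rewrite mulr_sumr; apply: eq_bigr => i _; rewrite mxE mulrA. Qed.

Lemma dotNl x y : dot (- x)%R y = (- dot x y)%R.
Proof. by rewrite -scaleN1r dotZl mulN1r. Qed.

Lemma dotDr x y z : dot x (y + z)%R = (dot x y + dot x z)%R.
Proof. by rewrite dotC dotDl !(dotC x). Qed.

Lemma dotZr a x y : dot x (a *: y)%R = (a * dot x y)%R.
Proof. by rewrite dotC dotZl (dotC x). Qed.

Lemma dotNr x y : dot x (- y)%R = (- dot x y)%R.
Proof. by rewrite dotC dotNl (dotC x). Qed.

Definition dotE := (dotDl, dotDr, dotNl, dotNr, dotZl, dotZr).

Lemma dot_ge0 x : (0 <= dot x x)%R.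
Proof. by apply: sumr_ge0 => i _; rewrite -expr2 sqr_ge0. Qed.

Lemma dot0l x : dot 0%R x = 0%R.
Proof. by rewrite /dot big1// => i _; rewrite mxE mul0r. Qed.

Lemma qE x : q x = (2^-1 * dot x x)%:E.
Proof. by rewrite /q /enorm sqr_sqrtr ?dot_ge0. Qed.

(** The max-norm is attained at a coordinate whose square is one of the nonnegative summands of
    [dot x x]. *)
Lemma norm_sqr_le_dot x : (`|x| ^+ 2 <= dot x x)%R.
Proof.
have [->|x0] := eqVneq x 0%R; first by rewrite normr0 expr0n dot_ge0.
have /mx_norm_neq0[[i j] ij] : mx_norm x != 0%R.
  by move: x0; rewrite -normr_eq0.
rewrite {1}/Num.norm/= ij/= (ord1 i) real_normK ?num_real// /dot.
rewrite (bigD1 j)//= -expr2 lerDl.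
by apply: sumr_ge0 => k _; rewrite -expr2 sqr_ge0.
Qed.

Lemma continuous_dot x : continuous (fun y => dot (y - x)%R (y - x)%R).
Proof.
apply: continuous_big => [|i _]; first exact: add_continuous.
have c : continuous (fun y : 'rV[R]_n => (y - x)%R ord0 i).
  rewrite (_ : (fun y => _) = (fun y : 'rV[R]_n => y ord0 i - x ord0 i)%R).
    move=> y; apply: continuousB; first exact: coord_continuous.
    exact: cst_continuous.
  by apply/funext => y; rewrite !mxE.
by move=> y; apply: continuousM; exact: c.
Qed.

End dot.

(** * Lower semicontinuity and minima on compact sets *)

Lemma lte_dense (R : realFieldType) (x y : \bar R) :
  x < y -> exists2 r, x < r%:E & r%:E < y.
Proof.
move: x y => [x| |] [y| |]// xy.
- by exists ((x + y) / 2)%R; rewrite lte_fin midf_lt.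
- by exists (x + 1)%R; rewrite ?ltry// lte_fin ltrDl.
- by exists (y - 1)%R; rewrite ?ltNyr// lte_fin ltrBlDr ltrDl.
- by exists 0%R; rewrite ?ltNyr ?ltry.
Qed.

Lemma lower_semicontinuous_addr (R : realType) (T : topologicalType)
    (f : T -> \bar R) (g : T -> R) :
  lower_semicontinuous f -> continuous g ->
  lower_semicontinuous (fun x => f x + (g x)%:E).
Proof.
move=> flsc gc x a; rewrite -lteBlDr// -EFinB => /lte_dense[b].
rewrite lte_fin ltrBlDr -ltrBlDl => ab /flsc[V xV fV].
exists (V `&` [set y | a - b < g y]%R)%classic.
  by apply: filterI => //; exact: (cvgr_gt (g x) (gc x)).
move=> y [/fV by_ /= ag]; rewrite -lteBlDr// -EFinB (le_lt_trans _ by_)//.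
by rewrite lee_fin; lra.
Qed.

(** Were the infimum [m] not attained, the open sets where [f] exceeds [a], for real [a] above [m],
    would cover [K]; compactness then gives a single such [a] bounding [f] below on [K], which is
    absurd. *)
Lemma lower_semicontinuous_min (R : realType) (T : topologicalType)
    (f : T -> \bar R) (K : set T) :
  lower_semicontinuous f -> compact K -> (K !=set0)%classic ->
  exists2 c, K c & forall x, K x -> f c <= f x.
Proof.
move=> flsc cK [x0 Kx0]; apply: contrapT => nomin.
pose m := ereal_inf (f @` K)%classic.
have mf x : K x -> m < f x.
  move=> Kx; rewrite ltNge; apply/negP => fm; apply: nomin; exists x => // y Ky.
  by apply: le_trans fm _; apply: ereal_inf_lbound; exists y.
(* A property holds along [F] when it holds for all reals up to some [a] above [m]; this also covers
   [m] = -oo. *)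
pose F := filter_from [set a : R | m < a%:E]%classic
  (fun a => [set b : R | b <= a]%R%classic).
have FF : Filter F.
  apply: filter_from_filter => [|a b /= ma mb].
    by have [a ma _] := lte_dense (mf _ Kx0); exists a.
  exists (Order.min a b) => /=; first by case: (leP a b).
  by move=> c /=; rewrite le_min => /andP[].
have /(_ _ F (fun a x => a%:E < f x) FF)[x Kx|a /= ma /(_ a (lexx a)) Ka] :=
    (compact_near_coveringP K).1 cK.
  have [a ma /flsc[V xV fV]] := lte_dense (mf _ Kx).
  exists (V, [set b : R | b <= a]%R%classic) => /=.
    by split=> //; exists a.
  by move=> [y b]/= [/fV ay ba]; apply: le_lt_trans ay; rewrite lee_fin.
move: ma; rewrite ltNge => /negP; apply.
by apply: le_ereal_inf_tmp => _ [x Kx <-]; exact/ltW/Ka.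
Qed.

Lemma compact_closed_ball (R : realType) n (x : 'rV[R]_n) (r : R) :
  (0 < r)%R -> compact (closed_ball x r).
Proof.
move=> r0; apply: bounded_closed_compact; last exact: closed_ball_closed.
rewrite closed_ballE//; exists (`|x| + r)%R; split=> [|M xM y /= yx].
  exact: num_real.
apply/ltW; apply: le_lt_trans xM.
rewrite -[y](subKr x); apply: le_trans (ler_normB _ _) _.
by rewrite lerD2l.
Qed.

(** * Subgradient calculus for conjugates, envelopes and proximal averages *)

Section subgradient.
Context {R : realType} {n : nat}.
Local Notation X := 'rV[R]_n.
Implicit Types (f g : X -> \bar R) (p v w x y : X) (a b k l : R).

(** Finiteness excludes [f p] = -oo, where the inequality would be trivial. *)
Definition subgradient f p v :=
  f p \is a fin_num /\ forall y, f p + (dot v (y - p)%R)%:E <= f y.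

Lemma subgradient0 p : subgradient (fun=> 0) p 0.
Proof. by split=> // y; rewrite dot0l add0e. Qed.

Lemma subgradient_q p : subgradient q p p.
Proof.
split=> [|y]; first by rewrite qE.
rewrite !qE -EFinD lee_fin.
have := dot_ge0 (y - p)%R; rewrite !dotE (dotC y p); lra.
Qed.

Lemma subgradient_comb f g p v w a b : (0 <= a)%R -> (0 <= b)%R ->
  subgradient f p v -> subgradient g p w ->
  subgradient (fun x => a%:E * f x + b%:E * g x) p (a *: v + b *: w)%R.
Proof.
move=> a0 b0 [/fineK fp fv] [/fineK gp gw]; rewrite /subgradient.
move: fv gw; rewrite -fp -gp => fv gw; split=> // y.
have /(lee_wpmul2l (_ : 0 <= a%:E)) := fv y; rewrite lee_fin => /(_ a0) H1.
have /(lee_wpmul2l (_ : 0 <= b%:E)) := gw y; rewrite lee_fin => /(_ b0) H2.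
apply: le_trans (leeD H1 H2).
by rewrite /= -!(EFinM, EFinD) lee_fin dotDl !dotZl; lra.
Qed.

Lemma subgradient_addq f p v :
  subgradient f p v -> subgradient (f \+ q) p (v + p)%R.
Proof.
move=> fv; rewrite (_ : f \+ q = fun x => 1%:E * f x + 1%:E * q x); last first.
  by apply/funext => x; rewrite !mul1e.
rewrite -[v]scale1r -[X in (_ + X)%R]scale1r.
exact: subgradient_comb fv (subgradient_q p).
Qed.

(** Equality case of Fenchel-Young: [p] maximizes <y, v> - f(y) over y. *)
Lemma conjugate_subgradient f p v : subgradient f p v ->
  conjugate f v = (dot p v)%:E - f p.
Proof.
move=> [/fineK fp fv]; apply/eqP; rewrite eq_le; apply/andP; split; last first.
  by apply: ereal_sup_ubound; exists p.
apply: ge_ereal_sup => _ [y _ <-].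
have := fv y; rewrite -fp.
case: (f y) => [r| |]//=; rewrite -?EFinD ?lee_fin ?leNye//.
rewrite !dotE (dotC v p) (dotC v y); lra.
Qed.

(** The affine map w -> <p, w> - f(p) is one of those in the supremum, and it touches the conjugate
    at [v]. *)
Lemma subgradient_conjugate f p v :
  subgradient f p v -> subgradient (conjugate f) v p.
Proof.
move=> fv; have [/fineK fp _] := fv.
split=> [|w]; rewrite (conjugate_subgradient fv) -fp -EFinB// -EFinD.
apply: le_trans (ereal_sup_ubound _); last by exists p.
by rewrite -fp lee_fin !dotE; lra.
Qed.

(** Once [f y] is replaced by its affine minorant at [p], the difference of the two sides is a
    multiple of a square. *)
Lemma moreau_ge f p v l w : (0 < l)%R -> subgradient f p v ->
  f p + (l / 2 * dot v v + dot v (w - p - l *: v)%R)%:E <= moreau l f w.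
Proof.
move=> l0 [/fineK fp fv]; apply: le_ereal_inf_tmp => _ [y _ <-].
apply: le_trans (leeD (fv y) (lexx _)).
rewrite -fp qE -EFinM -!EFinD lee_fin -subr_ge0.
rewrite (_ : (_ - _)%R = (2 * l)^-1 *
  dot (w - y - l *: v)%R (w - y - l *: v)%R)%R.
  by rewrite mulr_ge0 ?dot_ge0// invr_ge0 mulr_ge0// ltW.
rewrite !dotE (dotC w v) (dotC w y) (dotC y v); field.
exact: lt0r_neq0.
Qed.

(** The infimum is attained at [p]: the linear term of [moreau_ge] vanishes at this point. *)
Lemma moreau_subgradient f p v l : (0 < l)%R -> subgradient f p v ->
  moreau l f (p + l *: v)%R = f p + (l / 2 * dot v v)%:E.
Proof.
move=> l0 fv; apply/eqP; rewrite eq_le; apply/andP; split.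
  apply: ereal_inf_lbound; exists p => //.
  rewrite qE -EFinM addrAC subrr add0r !dotE; congr (_ + _%:E); field.
  exact: lt0r_neq0.
apply: le_trans (moreau_ge _ l0 fv).
rewrite (_ : p + l *: v - p - l *: v = 0)%R; last by rewrite addrAC addrK subrr.
by rewrite dotC dot0l addr0.
Qed.

Lemma subgradient_moreau f p v l : (0 < l)%R -> subgradient f p v ->
  subgradient (moreau l f) (p + l *: v)%R v.
Proof.
move=> l0 fv; have [/fineK fp _] := fv.
rewrite /subgradient (moreau_subgradient l0 fv).
split=> [|y]; first by rewrite -fp.
apply: le_trans (moreau_ge _ l0 fv).
by rewrite -fp -!EFinD lee_fin opprD !addrA.
Qed.

(** The common value u of the two sums is a subgradient of [f \+ q] at [p1] and of [g \+ q] at [p2].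
    Inverting, the weighted sum of conjugates has subgradient [a *: p1 + b *: p2] at u, so the outer
    conjugate is explicit too. *)
Lemma pav_subgradient f g p1 v1 p2 v2 a b : (0 <= a)%R -> (0 <= b)%R ->
  (p1 + v1 = p2 + v2)%R -> subgradient f p1 v1 -> subgradient g p2 v2 ->
  pav f g a b (a *: p1 + b *: p2)%R =
  a%:E * (f p1 + q p1) + b%:E * (g p2 + q p2) - q (a *: p1 + b *: p2)%R.
Proof.
move=> a0 b0 e fv gv; have [/fineK fp _] := fv; have [/fineK gp _] := gv.
have Hf := subgradient_addq fv; have := subgradient_addq gv.
rewrite (addrC v2) -e (addrC p1) => Hg.
rewrite /pav (conjugate_subgradient (subgradient_comb a0 b0
  (subgradient_conjugate Hf) (subgradient_conjugate Hg))).
rewrite !(conjugate_subgradient Hf) !(conjugate_subgradient Hg)/=.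
rewrite -fp -gp !qE -!(EFinM, EFinN, EFinD).
congr _%:E; rewrite !dotE (dotC p2 p1) (dotC v1 p1) (dotC v1 p2); ring.
Qed.

(** * Existence of proximal points and Minty's decomposition *)

(* Convexity propagates the minimum over the unit ball at [x0] outwards along
   rays. *)
Lemma convex_linear_lower_bound f x0 : convex_fun f -> lower_semicontinuous f ->
  (forall x, -oo < f x) -> f x0 < +oo ->
  exists2 C, (0 <= C)%R & forall y, (1 < `|y - x0|)%R ->
    f x0 - (C * `|y - x0|)%:E <= f y.
Proof.
move=> fc flsc fNy x0y.
have K0 : closed_ball x0 1%R x0 by exact: closed_ballxx.
have [||p Kp pmin] := @lower_semicontinuous_min _ _ _ (closed_ball x0 1%R) flsc.
- exact: compact_closed_ball.
- by exists x0.
have /fineK fp : f p \is a fin_num.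
  by rewrite fin_numElt fNy (le_lt_trans (pmin _ K0)).
have /fineK fx0 : f x0 \is a fin_num by rewrite fin_numElt fNy.
have := pmin _ K0; rewrite -fp -fx0 lee_fin => ma.
exists (fine (f x0) - fine (f p))%R; first by rewrite subr_ge0.
move=> y; set s := `|y - x0|%R => s1.
have s0 : (0 < s)%R by apply: lt_trans s1.
have t01 : (0 < s^-1 < 1)%R by rewrite invr_gt0 s0 invf_lt1.
have := fc y x0 _ t01.
(* The point at parameter 1/s on the segment from [x0] to [y] has distance 1 from [x0]. *)
have /pmin : closed_ball x0 1%R (s^-1 *: y + (1 - s^-1) *: x0)%R.
  rewrite closed_ballE// /closed_ball_ /= scalerBl scale1r addrCA -scalerBr.
  rewrite opprD addNKr normrN normrZ gtr0_norm; last by case/andP: t01.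
  by rewrite mulVf ?lt0r_neq0.
move=> /le_trans /[apply]; have := fNy y.
case: (f y) => [r| |]// _; last by rewrite leey.
rewrite -fp -fx0 -!EFinM -!EFinD !lee_fin -(ler_pM2l s0).
rewrite [leRHS](_ : _ = r + (s - 1) * fine (f x0))%R; first lra.
by field; exact: lt0r_neq0.
Qed.

(* The linear lower bound on [f] makes the minimizer over a large ball a global
   one. *)
Lemma exists_proximal_point f x k : convex_fun f -> lower_semicontinuous f ->
  proper_fun f -> (0 < k)%R ->
  exists2 p, f p \is a fin_num & forall y,
    f p + (k * dot (p - x)%R (p - x)%R)%:E <=
    f y + (k * dot (y - x)%R (y - x)%R)%:E.
Proof.
move=> fc flsc [fNy [x0 x0y]] k0.
have /fineK fx0 : f x0 \is a fin_num by rewrite fin_numElt fNy.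
have [C C0 fC] := convex_linear_lower_bound fc flsc fNy x0y.
pose d := `|x0 - x|%R; pose e := dot (x0 - x)%R (x0 - x)%R.
have d0 : (0 <= d)%R := normr_ge0 _.
have e0 : (0 <= e)%R := dot_ge0 _.
pose A := (C / k)%R.
have A0 : (0 <= A)%R by rewrite divr_ge0// ltW.
have CE : C = (k * A)%R by rewrite mulrC divfK ?lt0r_neq0.
have Ad0 : (0 <= A * d)%R by rewrite mulr_ge0.
(* Outside this ball, u = |y - x0| - d is so large that k u^2 outweighs the linear loss C (u + d)
   plus the value k e at [x0]. *)
pose M := (d + 1 + A + A * d + e)%R.
have M0 : (0 < M)%R by rewrite /M; lra.
have K0 : closed_ball x0 M x0 by exact: closed_ballxx.
have Flsc : lower_semicontinuous
    (fun y => f y + (k * dot (y - x)%R (y - x)%R)%:E).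
  apply: lower_semicontinuous_addr => // y.
  exact: (continuousM (@cst_continuous _ _ k y) (@continuous_dot _ _ x y)).
have [||p Kp pmin] := @lower_semicontinuous_min _ _ _ (closed_ball x0 M) Flsc.
- exact: compact_closed_ball.
- by exists x0.
exists p => [|y].
  rewrite fin_numElt fNy/=; have := pmin _ K0; rewrite -fx0 -EFinD.
  by case: (f p) => // r _; rewrite ltry.
have [/pmin//|] := pselect (closed_ball x0 M y).
rewrite closed_ballE// /closed_ball_ /= distrC => /negP; rewrite -ltNge => yM.
apply: le_trans (pmin _ K0) _.
apply: le_trans (leeD (fC y _) (lexx _)); last first.
  by apply: le_lt_trans yM; rewrite /M; lra.
rewrite -fx0 -!(EFinM, EFinN, EFinD) lee_fin -/e.
move: yM; set s := `|y - x0|%R => yM.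
have sd : (s - d <= `|y - x|)%R.
  by rewrite lerBlDr /s /d -(subrKA x y) -(opprB x0 x) ler_normB.
have sd0 : (0 <= s - d)%R by move: yM; rewrite /M; lra.
have H : ((s - d) ^+ 2 <= dot (y - x)%R (y - x)%R)%R.
  by apply: le_trans (norm_sqr_le_dot _); rewrite ler_sqr ?nnegrE.
apply: (@le_trans _ _ (fine (f x0) - C * s + k * (s - d) ^+ 2)%R); last first.
  by rewrite lerD2l ler_pM2l.
rewrite CE -addrA lerD2l -mulrA -mulrN -mulrDr ler_pM2l//.
rewrite -[s in leRHS](subrK d); set u := (s - d)%R.
have u1 : (1 + A + A * d + e <= u)%R by move: yM; rewrite /M /u; lra.
(* As u is at least 1, the left side is at least A u + A d + e. *)
suff : (u * (1 + A + A * d + e) <= u ^+ 2)%R by nra.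
by rewrite expr2 ler_wpM2l//; lra.
Qed.

(* Minimality of the proximal point [p] along the segment towards [y] reads
   [0 <= t (A + t B)] for [0 < t < 1]; letting [t] be small gives [0 <= A], the
   subgradient inequality. *)
Lemma minty f l x : convex_fun f -> lower_semicontinuous f -> proper_fun f ->
  (0 < l)%R -> exists p v, subgradient f p v /\ x = (p + l *: v)%R.
Proof.
move=> fc flsc fproper l0.
have k0 : (0 < (2 * l)^-1)%R by rewrite invr_gt0 mulr_gt0.
have [p pfin pmin] := exists_proximal_point x fc flsc fproper k0.
exists p, (l^-1 *: (x - p))%R; split; last first.
  by rewrite scalerA mulfV ?lt0r_neq0// scale1r addrC subrK.
split=> // y; have /fineK fp := pfin.
have := fproper.1 y; case fy : (f y) => [r| |]// _; last by rewrite leey.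
rewrite -fp -EFinD lee_fin.
set B := ((2 * l)^-1 * dot (y - p)%R (y - p)%R)%R.
have B0 : (0 <= B)%R by rewrite mulr_ge0 ?dot_ge0// ltW.
rewrite -subr_ge0; set A := (_ - _)%R; rewrite leNgt; apply/negP => A0.
have D0 : (0 < B - A + 1)%R by lra.
(* As A < 0 <= B, this [t] lies in ]0, 1[ and makes A + t B = A (1 - A) / (B - A + 1) negative. *)
pose t := (- A / (B - A + 1))%R.
have t01 : (0 < t < 1)%R.
  rewrite divr_gt0 ?oppr_gt0//= ltr_pdivrMr//; lra.
have := le_trans (pmin _) (leeD (fc y p _ t01) (lexx _)).
rewrite fy -fp -!(EFinM, EFinD) lee_fin -subr_ge0.
rewrite (_ : (_ - _)%R = t * (A + t * B))%R; last first.
  rewrite /A /B !dotE (dotC x p) (dotC x y) (dotC y p); field.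
  exact: lt0r_neq0.
rewrite pmulr_rge0; last by case/andP: t01.
rewrite leNgt (_ : (A + _)%R = A * (1 - A) / (B - A + 1))%R; last first.
  by rewrite /t; field; exact: lt0r_neq0.
by rewrite pmulr_llt0 ?invr_gt0// nmulr_rlt0// subr_gt0 (lt_trans A0)// ltr01.
Qed.

End subgradient.

(** * The three identities for the Goebel operator *)

Theorem theorem2p2 (R : realType) (n : nat) (f : 'rV[R]_n -> \bar R) (l : R)
    (f_convex : convex_fun f) (f_lsc : lower_semicontinuous f)
    (f_proper : proper_fun f) (l01 : (0 < l < 1)%R) :
  [/\ goebel l f = (fun x =>
        (1 + l)%:E * pav f (fun=> 0) (1 - l)%R l x + l%:E * q x),
      goebel l f = (fun x =>
        ((1 + l) ^+ 2)%:E *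
          pav f q ((1 - l) / (1 + l))%R (2 * l / (1 + l))%R
            ((1 + l)^-1 *: x)%R)
    & conjugate (goebel l f) = goebel l (conjugate f)].
Proof.
have [l0 l1] := andP l01.
have l1' : (0 < 1 + l)%R by rewrite ltr_wpDl.
have l1'0 := lt0r_neq0 l1'.
have l'0 := lt0r_neq0 l0.
have lB1 : (0 <= 1 - l)%R by rewrite subr_ge0 ltW.
split; apply/funext => x.
- have [y [v [fv ->]]] := minty x f_convex f_lsc f_proper l0.
  have [/fineK fp _] := fv.
  (* The zero function has subgradient 0 at y + v, so both pairs have sum y + v. *)
  rewrite [in RHS](_ : y + l *: v = (1 - l) *: y + l *: (y + v))%R; last first.
    by rewrite scalerBl scale1r scalerDr addrA subrK.
  rewrite (pav_subgradient lB1 (ltW l0) _ fv (subgradient0 _)) ?addr0//.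
  rewrite /goebel (moreau_subgradient l0 fv) -fp !qE.
  rewrite /= add0e -!(EFinM, EFinN, EFinD).
  by congr _%:E; rewrite !dotE (dotC v y); field.
- have [y [v [fv ->]]] := minty x f_convex f_lsc f_proper l0.
  have [/fineK fp _] := fv.
  (* A point is its own subgradient for [q], so matching the sum y + v forces the point (y + v) /
     2. *)
  rewrite [in RHS](_ : (1 + l)^-1 *: (y + l *: v) =
     (1 - l) / (1 + l) *: y + 2 * l / (1 + l) *: (2^-1 *: (y + v)))%R; last first.
    rewrite scalerA !scalerDr addrA -scalerDl scalerA.
    by congr (_ *: _ + _ *: _)%R; field.
  have a0 : (0 <= (1 - l) / (1 + l))%R by rewrite divr_ge0// ltW.
  have b0 : (0 <= 2 * l / (1 + l))%R
    by rewrite divr_ge0 ?ltW ?mulr_gt0.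
  have yv : (y + v = 2^-1 *: (y + v) + 2^-1 *: (y + v))%R.
    by rewrite -scalerDl (_ : 2^-1 + 2^-1 = 1 :> R)%R ?scale1r//; field.
  rewrite (pav_subgradient a0 b0 yv fv (subgradient_q _)).
  rewrite /goebel (moreau_subgradient l0 fv) -fp !qE.
  rewrite -!(EFinM, EFinN, EFinD).
  by congr _%:E; rewrite !dotE (dotC v y); field.
- have li0 : (0 < l^-1)%R by rewrite invr_gt0.
  (* Parameter 1/l at x/l, scaled by l, gives x = l y + v. *)
  have [y [v [fv]]] := minty (l^-1 *: x)%R f_convex f_lsc f_proper li0.
  move=> /(congr1 (fun z => l *: z)%R).
  rewrite scalerDr !scalerA mulfV// !scale1r => ->.
  have [/fineK fp _] := fv.
  have sl : (0 <= 1 - l ^+ 2)%R.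
    by rewrite subr_ge0 expr_le1// ltW.
  (* At y + l v the function [goebel l f] has subgradient (1 - l^2) v + l (y + l v) = l y + v = x,
     so its conjugate at x is explicit. *)
  have := subgradient_comb sl (ltW l0) (subgradient_moreau l0 fv)
    (subgradient_q _).
  rewrite (_ : _ + _ = l *: y + v)%R; last first.
    by rewrite scalerDr scalerA addrCA -scalerDl -expr2 subrK scale1r.
  move=> /conjugate_subgradient; rewrite -/(goebel l f) => ->.
  (* On the right, x = v + l y with y a subgradient of the conjugate at v. *)
  rewrite (addrC (l *: y)%R) /goebel (moreau_subgradient l0 fv).
  rewrite (moreau_subgradient l0 (subgradient_conjugate fv)).
  rewrite (conjugate_subgradient fv) -fp !qE -!(EFinM, EFinN, EFinD).
  by congr _%:E; rewrite !dotE (dotC v y); field.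
Qed.
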